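(* Let $n \ge 4$ and let $Q^R \in \mathbb{M}^{n(n-1)}$ be in quadratic reduced form. Let $\bar{Q}$ be the principal submatrix of $Q^R$ obtained by deleting the rows and columns indexed by arcs in $\{(n,p),(p,n) : p \in N_n\}$, so that $\bar Q$ has rows and columns indexed by the arcs of the complete directed graph on $N_n$, with entries $\bar q_{ijuv}$. For distinct $i,j\in N_n$ define the $(n-1)\times(n-1)$ matrix $Z^{ij}$ (indexed by $N_n$) by $z^{ij}_{uv} = 0$ if $(u,v)=(i,j)$ and $z^{ij}_{uv} = \bar q_{ijuv}$ for arcs $(u,v)\neq(i,j)$. Then $Q^R$ is linearizable if and only if there exists a real matrix $F = (f_{ij})$ indexed by $N_n$ such that (1) $Z^{ij}(\tau) - Z^{k\ell}(\tau) = \frac{1}{2}(f_{ij} - f_{k\ell})$ for every $\tau \in \mathcal{T}_{n-1}$ and all arcs $(i,j),(k,\ell) \in \tau$, and (2) $\frac{n-2}{n-3}F$ is a linearization of $\bar{Q}$, i.e. $\bar Q[\tau] = \frac{n-2}{n-3}F(\tau)$ for all $\tau\in\mathcal{T}_{n-1}$.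
   Context: $N = \{1,\dots,n\}$, $N_n = N\setminus\{n\}$. For a finite vertex set $V$, a tour on $V$ is a directed Hamiltonian cycle in the complete directed graph on $V$, identified with its arc set; $\mathcal{T}_n$ is the set of tours on $N$ and $\mathcal{T}_{n-1}$ the set of tours on $N_n$. $\mathbb{M}^n$ is the space of real $n\times n$ matrices indexed by $N$; $\mathbb{M}^{n(n-1)}$ is the space of real matrices with rows and columns indexed by the arcs $(i,j)$, $i\ne j$, of the complete directed graph on $N$, the entry in row $(i,j)$ and column $(k,\ell)$ written $q_{ijk\ell}$. For such a matrix $Q$ (on any vertex set) and a tour $\tau$, $Q[\tau] := \sum_{(e,f)\in\tau\times\tau} q_{ef}$; for a square matrix $C$ indexed by the vertex set, $C(\tau) := \sum_{(i,j)\in\tau} c_{ij}$. $Q$ is linearizable if there is $C$ with $Q[\tau]=C(\tau)$ for all tours $\tau$; $C$ is then a linearization of $Q$. $Q \in \mathbb{M}^{n(n-1)}$ is in quadratic reduced form if it is symmetric, has zero diagonal, and all entries in rows or columns indexed by arcs in $\{(n,p),(p,n) : p\in N_n\}$ are zero. *)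

(* Defs.v *)
From mathcomp Require Import all_boot all_order all_algebra.
From mathcomp Require Import reals.

Set Implicit Arguments.
Unset Strict Implicit.
Unset Printing Implicit Defensive.

Import GRing.Theory.
Local Open Scope ring_scope.

(* The vertex set {1, ..., k} is represented by 'I_k; an arc is an ordered
   pair of distinct vertices. *)
Definition darc (k : nat) := {a : 'I_k * 'I_k | a.1 != a.2}.

Definition arc_tail k (a : darc k) : 'I_k := (val a).1.
Definition arc_head k (a : darc k) : 'I_k := (val a).2.

(* [s] lists every vertex exactly once, and the arcs of the tour go from each
   vertex to its cyclic successor in [s]. *)
Definition is_tour k (tau : {set darc k}) : Prop :=
  exists s : seq 'I_k,
    [/\ uniq s, s =i predT
      & tau = [set a : darc k | arc_head a == next s (arc_tail a)]].

Section Costs.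
Variables (R : realType) (k : nat).

(* The entry in row e and column f of an arc-indexed matrix Q is [Q e f]. *)
Definition arc_matrix := darc k -> darc k -> R.

Definition quad_cost (Q : arc_matrix) (tau : {set darc k}) : R :=
  \sum_(e in tau) \sum_(f in tau) Q e f.

Definition lin_cost (C : 'M[R]_k) (tau : {set darc k}) : R :=
  \sum_(a in tau) C (arc_tail a) (arc_head a).

Definition is_linearization (Q : arc_matrix) (C : 'M[R]_k) : Prop :=
  forall tau : {set darc k}, is_tour tau -> quad_cost Q tau = lin_cost C tau.

Definition linearizable (Q : arc_matrix) : Prop :=
  exists C : 'M[R]_k, is_linearization Q C.

(* The last vertex is the ordinal with value k.-1. *)
Definition meets_last (a : darc k) : bool :=
  (arc_tail a == k.-1 :> nat) || (arc_head a == k.-1 :> nat).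

Definition quadratic_reduced_form (Q : arc_matrix) : Prop :=
  [/\ forall e f, Q e f = Q f e,
      forall e, Q e e = 0
    & forall e f, meets_last e || meets_last f -> Q e f = 0].

(* The matrix Z^{ij} for e = (i, j). The diagonal entries are set to 0, but they
   do not occur in the cost of a tour. *)
Definition row_matrix (Q : arc_matrix) (e : darc k) : 'M[R]_k :=
  \matrix_(u, v)
    if insub (u, v) is Some f then (if f == e then 0 else Q e f) else 0.

End Costs.

(* Vertices other than the last one: 'I_n.-1, embedded in 'I_n with the same
   values. *)
Definition widen_vertex n (i : 'I_n.-1) : 'I_n := widen_ord (leq_pred n) i.

Fact widen_arc_subproof n (a : darc n.-1) :
  widen_vertex (arc_tail a) != widen_vertex (arc_head a).
Proof. exact: valP a. Qed.

Definition widen_arc n (a : darc n.-1) : darc n :=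
  exist (fun b : 'I_n * 'I_n => b.1 != b.2)
    (widen_vertex (arc_tail a), widen_vertex (arc_head a))
    (widen_arc_subproof a).

Definition delete_last (R : realType) n (Q : arc_matrix R n) :
    arc_matrix R n.-1 :=
  fun e f => Q (widen_arc e) (widen_arc f).

(* Main.v *)
(** Inserting the last vertex into an arc e of a tour tau on the other vertices
    produces every tour on all vertices. Since Q vanishes on the arcs at the
    last vertex, the quadratic cost of the new tour is Qbar[tau] - 2 Z^e(tau),
    while its linear cost under C is C(tau) - G_e with
    G_ij = c_ij - c_in - c_nj. Hence Q is linearizable iff
    Qbar[tau] - 2 Z^e(tau) = C(tau) - G_e for all tau and all e in tau.
    Averaging over e in tau, and using that the sum S of all c_in + c_nj is the
    same for every tau, shows that F = G + S / (n - 2) works; conversely F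
    satisfies the equations with C = F extended by zero. *)
Require Import Defs.
From mathcomp Require Import all_boot all_order all_algebra.
From mathcomp Require Import reals.
From mathcomp Require Import ring lra.

Set Implicit Arguments.
Unset Strict Implicit.
Unset Printing Implicit Defensive.

Import GRing.Theory.
Local Open Scope ring_scope.

(** * Cyclic successors and sums over a tour *)

Lemma next_at_last (T : eqType) (y0 y : T) p :
  uniq (y :: p) -> next_at (last y p) y0 y p = y0.
Proof.
elim: p y => [|z p IH] y /=; first by rewrite eqxx.
case/andP=> hy up; case: eqP => [h|_]; last exact: IH.
by move: hy; rewrite -h mem_last.
Qed.

(** The default value is read only at the last entry, so a new head in front of a cycle changes the
    successor of that entry alone. *)
Lemma next_at_neq_last (T : eqType) (x y0 y1 y : T) p :
  x != last y p -> next_at x y0 y p = next_at x y1 y p.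
Proof.
elim: p y => [|z p IH] y /=; first by move/negbTE=> ->.
by move=> h; case: eqP => // _; apply: IH.
Qed.

Lemma darc_inj k (a b : darc k) :
  arc_tail a = arc_tail b -> arc_head a = arc_head b -> a = b.
Proof.
move=> ht hh; apply: val_inj; move: ht hh; rewrite /arc_tail /arc_head.
by case: (val a) (val b) => [? ?] [? ?] /= -> ->.
Qed.

Definition tour_of k (s : seq 'I_k) : {set darc k} :=
  [set a : darc k | arc_head a == next s (arc_tail a)].

Lemma tour_of_rot k r (s : seq 'I_k) : uniq s -> tour_of (rot r s) = tour_of s.
Proof. by move=> us; apply/setP => a; rewrite !inE next_rot. Qed.

(** This is what makes [(i, next s i)] an arc. With [i] rotated to the front, its successor is the
    second entry, which differs from [i] by uniqueness. *)
Lemma next_neq k (s : seq 'I_k) (i : 'I_k) :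
  (2 <= k)%N -> uniq s -> s =i predT -> i != next s i.
Proof.
move=> hk us fs; have /rot_to [r q hr] : i \in s by rewrite fs.
rewrite -(next_rot r us) hr; move: us fs; rewrite -(rot_uniq r) hr => us fs.
have fq z : z \in i :: q by rewrite -hr mem_rot fs.
case: q us fq {hr fs} => [|y q] /= us fq; last first.
  by rewrite eqxx; move: us; rewrite inE negb_or => /andP[/andP[]].
(* Without a second entry all vertices would coincide, against the ordinals 0 and 1. *)
have all_i z : z = i by have := fq z; rewrite inE => /eqP.
have h0 : (0 < k)%N by apply: leq_trans hk.
by have := congr1 val (etrans (all_i (Ordinal hk)) (esym (all_i (Ordinal h0)))).
Qed.

(** The tail map is a bijection from the tour to the vertices: the tail determines the head, and
    every vertex has an outgoing arc. *)
Lemma sum_tour_tail (V : nmodType) k (tau : {set darc k}) (g : 'I_k -> V) :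
  (2 <= k)%N -> is_tour tau -> \sum_(a in tau) g (arc_tail a) = \sum_i g i.
Proof.
move=> hk [s [us fs ->]]; set T := [set _ | _].
have inj : {in T &, injective (@arc_tail k)}.
  move=> a b; rewrite !inE => /eqP ha /eqP hb hab.
  by apply: darc_inj => //; rewrite ha hb hab.
rewrite -(big_imset g inj) /=; apply: eq_bigl => i; apply/imsetP.
exists (exist (fun b : 'I_k * 'I_k => b.1 != b.2) (i, next s i)
         (next_neq i hk us fs)); rewrite ?inE //=.
Qed.

Lemma sum_tour_head (V : nmodType) k (tau : {set darc k}) (g : 'I_k -> V) :
  (2 <= k)%N -> is_tour tau -> \sum_(a in tau) g (arc_head a) = \sum_i g i.
Proof.
move=> hk ht; have [s [us fs dtau]] := ht.
rewrite (reindex_inj (can_inj (prev_next us))) /=.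
rewrite -(sum_tour_tail _ hk ht); apply: eq_bigr => a.
by rewrite dtau inE => /eqP ->.
Qed.

Lemma card_tour k (tau : {set darc k}) :
  (2 <= k)%N -> is_tour tau -> #|tau| = k.
Proof.
move=> hk ht; rewrite -sum1_card.
by rewrite (sum_tour_tail (fun=> 1%N) hk ht) sum1_card card_ord.
Qed.

(** * Inserting the last vertex into an arc *)

Section Insertion.
Variable m : nat.
Implicit Types (tau : {set darc m}) (e : darc m) (i : 'I_m).

Local Notation widen := (@widen_vertex m.+1 : 'I_m -> 'I_m.+1).
Local Notation widena := (@widen_arc m.+1 : darc m -> darc m.+1).

Lemma widen_vertex_inj : injective widen.
Proof. by move=> i j /(congr1 val) /= h; apply: val_inj. Qed.

Lemma widen_vertex_neq_max i : widen i != ord_max.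
Proof. by rewrite -val_eqE /= neq_ltn ltn_ord. Qed.

Lemma max_neq_widen_vertex i : ord_max != widen i.
Proof. by rewrite eq_sym widen_vertex_neq_max. Qed.

Lemma widen_arc_inj : injective widena.
Proof.
by move=> a b /(congr1 val) [ht hh]; apply: darc_inj; apply: val_inj.
Qed.

Lemma widen_vertex_surj (j : 'I_m.+1) : j != ord_max -> exists i, j = widen i.
Proof.
move=> hj; have lt_j : (j < m)%N.
  by rewrite ltn_neqAle -ltnS ltn_ord andbT; move: hj; rewrite -val_eqE.
by exists (Ordinal lt_j); apply: val_inj.
Qed.

Definition in_arc i : darc m.+1 :=
  exist (fun b : 'I_m.+1 * 'I_m.+1 => b.1 != b.2) (widen i, ord_max)
    (widen_vertex_neq_max i).

Definition out_arc i : darc m.+1 :=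
  exist (fun b : 'I_m.+1 * 'I_m.+1 => b.1 != b.2) (ord_max, widen i)
    (max_neq_widen_vertex i).

Definition insert_last tau e : {set darc m.+1} :=
  in_arc (arc_tail e) |: (out_arc (arc_head e) |: widena @: (tau :\ e)).

Lemma sum_insert_last (V : nmodType) (g : darc m.+1 -> V) tau e :
  \sum_(a in insert_last tau e) g a =
  g (in_arc (arc_tail e)) + (g (out_arc (arc_head e))
    + \sum_(a in tau :\ e) g (widena a)).
Proof.
rewrite big_setU1 /=; last first.
  rewrite !inE negb_or; apply/andP; split.
    by rewrite -val_eqE xpair_eqE negb_and widen_vertex_neq_max.
  apply/imsetP => -[a _ /(congr1 val) [_ /eqP]].
  by rewrite eq_sym ltn_eqF.
rewrite big_setU1 /=; last first.
  apply/imsetP => -[a _ /(congr1 val) [/eqP]].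
  by rewrite eq_sym ltn_eqF.
by rewrite big_imset //=; move=> a b _ _; apply: widen_arc_inj.
Qed.

(** Here [e] is the closing arc of the cycle [x :: p], so prepending [ord_max] places the new vertex
    exactly between the two ends of [e]. *)
Lemma tour_of_cons_max (x : 'I_m) (p : seq 'I_m) e :
    uniq (x :: p) -> arc_tail e = last x p -> arc_head e = x ->
  tour_of (ord_max :: map widen (x :: p)) = insert_last (tour_of (x :: p)) e.
Proof.
move=> us te he; set s := x :: p.
have next_max : next (ord_max :: map widen s) ord_max = widen x.
  by rewrite /= eqxx.
have next_last : next (ord_max :: map widen s) (widen (last x p)) = ord_max.
  rewrite /= (negbTE (widen_vertex_neq_max _)) -last_map next_at_last //.
  by rewrite -map_cons (map_inj_uniq widen_vertex_inj).
have next_widen i : i != last x p ->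
    next (ord_max :: map widen s) (widen i) = widen (next s i).
  move=> hi; rewrite -(next_map widen_vertex_inj us) /=.
  rewrite (negbTE (widen_vertex_neq_max _)); apply: next_at_neq_last.
  by rewrite last_map (inj_eq widen_vertex_inj).
(* Only [e] leaves [last x p]; all other arcs keep their successor. *)
have e_last a : a \in tour_of s -> arc_tail a = last x p -> a = e.
  rewrite inE => /eqP ha ta; apply: darc_inj; first by rewrite ta te.
  by rewrite ha ta he /s /= next_at_last.
apply/setP => a; rewrite 3!inE; apply/eqP/idP.
(* The tail of [a] is the new vertex, the tail of [e], or another old vertex; these give [out_arc],
   [in_arc] and a widened arc. *)
- have [ta|/widen_vertex_surj [i ta]] := eqVneq (arc_tail a) ord_max.
    rewrite ta next_max => ha; apply/orP; right; rewrite inE; apply/orP; left.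
    by rewrite inE; apply/eqP/darc_inj => //; rewrite he ha.
  have [hi|hi] := eqVneq i (last x p).
    rewrite ta hi next_last => ha; apply/orP; left; apply/eqP/darc_inj => //.
    by rewrite ta hi te.
  rewrite ta next_widen // => ha; apply/orP; right; apply/setU1P; right.
  have hneq : i != next s i.
    by rewrite -(inj_eq widen_vertex_inj) -ta -ha; apply: (valP a).
  apply/imsetP; exists (exist (fun b : 'I_m * 'I_m => b.1 != b.2)
    (i, next s i) hneq); last exact: darc_inj.
  rewrite !inE /= eqxx andbT; apply: contraNneq hi => he'.
  by rewrite -te -he'.
case/orP => [/eqP ->|/setU1P [->|/imsetP [b hb ->]]].
- have -> : arc_tail (in_arc (arc_tail e)) = widen (last x p) by rewrite -te.
  by rewrite next_last.
- have -> : arc_tail (out_arc (arc_head e)) = ord_max by [].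
  by rewrite next_max -he.
move: hb; rewrite in_setD1 => /andP[hbe hb].
have -> : arc_tail (widena b) = widen (arc_tail b) by [].
rewrite next_widen; last first.
  by apply: contraNneq hbe => /(e_last _ hb) ->.
by move: hb; rewrite inE => /eqP <-.
Qed.

Lemma is_tour_insert_last tau e :
  is_tour tau -> e \in tau -> is_tour (insert_last tau e).
Proof.
case=> s [us fs ->] he; rewrite -/(tour_of s) in he *.
have /rot_to [r p hr] : arc_head e \in s by rewrite fs.
rewrite -(tour_of_rot r us) in he *; rewrite hr in he *.
move: us; rewrite -(rot_uniq r) hr => us.
have fp z : z \in arc_head e :: p by rewrite -hr mem_rot fs.
exists (ord_max :: map widen (arc_head e :: p)); split.
- rewrite cons_uniq (map_inj_uniq widen_vertex_inj) us andbT.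
  by apply/mapP => -[i _ /eqP]; apply/negP; apply: max_neq_widen_vertex.
- move=> z; rewrite [RHS]inE in_cons.
  have [//|/widen_vertex_surj [i ->]] := eqVneq z ord_max.
  by rewrite (mem_map widen_vertex_inj) fp.
rewrite -/(tour_of _) (@tour_of_cons_max _ _ e) //.
move: he; rewrite inE => /eqP he.
(* The tail of [e] and the last entry have the same successor, and [next] is injective. *)
by apply: (can_inj (prev_next us)); rewrite -he /= next_at_last.
Qed.

(** Rotate the tour to start at [ord_max] and drop it: the remaining entries form a tour whose
    closing arc is the wanted [e]. *)
Lemma is_tour_insert_lastP (sigma : {set darc m.+1}) :
    (2 <= m)%N -> is_tour sigma ->
  exists tau e, [/\ is_tour tau, e \in tau & sigma = insert_last tau e].
Proof.
move=> hm [s [us fs ->]]; rewrite -/(tour_of s).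
have /rot_to [r t hr] : ord_max \in s by rewrite fs.
rewrite -(tour_of_rot r us) hr.
move: us; rewrite -(rot_uniq r) hr => us.
have ft z : z \in ord_max :: t by rewrite -hr mem_rot fs.
have [p dt] : exists p, t = map widen p.
  have: ord_max \notin t by case/andP: us.
  elim: (t) => [|z u IH]; first by exists [::].
  rewrite in_cons negb_or eq_sym => /andP[/widen_vertex_surj [i ->]] /IH [p ->].
  by exists (i :: p).
move: us ft; rewrite {}dt => {hr} us ft.
have up : uniq p.
  by move: us; rewrite cons_uniq (map_inj_uniq widen_vertex_inj) => /andP[].
have fp : p =i predT.
  move=> i; have := ft (widen i).
  by rewrite in_cons (negbTE (widen_vertex_neq_max _)) (mem_map widen_vertex_inj).
have h0 : (0 < m)%N by apply: leq_trans hm.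
case: p up fp us ft => [|x p] up fp us ft; first by have := fp (Ordinal h0).
have nl : next (x :: p) (last x p) = x by rewrite /= next_at_last.
have hneq := next_neq (last x p) hm up fp.
pose e : darc m := exist (fun b : 'I_m * 'I_m => b.1 != b.2) (last x p, _) hneq.
exists (tour_of (x :: p)), e; split; first by exists (x :: p).
  by rewrite inE.
exact: tour_of_cons_max.
Qed.

(** [B] is kept separate from [C] so that it can be the restriction of a given [C], or the [F] that
    is extended to [C]. *)
Lemma lin_cost_insert_last (R : realType) (C : 'M[R]_m.+1) (B : 'M[R]_m) tau e :
    (forall i j, B i j = C (widen i) (widen j)) -> e \in tau ->
  lin_cost C (insert_last tau e) =
  lin_cost B tau - (B (arc_tail e) (arc_head e)
     - C (widen (arc_tail e)) ord_max - C ord_max (widen (arc_head e))).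
Proof.
move=> hB he; rewrite /lin_cost sum_insert_last /= [in RHS](big_setD1 e) //=.
have -> : \sum_(a in tau :\ e) C (arc_tail (widena a)) (arc_head (widena a))
    = \sum_(a in tau :\ e) B (arc_tail a) (arc_head a).
  by apply: eq_bigr => a _; rewrite hB.
rewrite /in_arc /out_arc /arc_tail /arc_head /=; ring.
Qed.

End Insertion.

(** * Quadratic cost under insertion *)

Lemma lin_cost_row_matrix (R : realType) k (Q : arc_matrix R k) (e : darc k)
    (tau : {set darc k}) :
  Q e e = 0 -> lin_cost (row_matrix Q e) tau = \sum_(f in tau) Q e f.
Proof.
move=> Qee; apply: eq_bigr => f _; rewrite mxE /arc_tail /arc_head.
by rewrite -surjective_pairing valK; case: eqP => // ->.
Qed.

(** The two new arcs contribute nothing, which leaves the sum over pairs in [tau :\ e]. This is the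
    full double sum without row and column [e]; by symmetry and the zero diagonal each of them sums
    to the cost of the row matrix. *)
Lemma quad_cost_insert_last (R : realType) m (Q : arc_matrix R m.+1)
    (tau : {set darc m}) (e : darc m) :
    quadratic_reduced_form Q -> e \in tau ->
  quad_cost Q (insert_last tau e) =
  quad_cost (delete_last Q) tau
    - 2 * lin_cost (row_matrix (delete_last Q) e) tau.
Proof.
move=> [Qsym Qdiag Qlast] he.
have in_last i : meets_last (in_arc i) by rewrite /meets_last /= eqxx orbT.
have out_last i : meets_last (out_arc i) by rewrite /meets_last /= eqxx.
pose Qb : arc_matrix R m := delete_last Q; rewrite -/Qb.
have Qbee : Qb e e = 0 by apply: Qdiag.
rewrite lin_cost_row_matrix // /quad_cost sum_insert_last.
rewrite big1 ?add0r => [|f _]; last by rewrite Qlast ?in_last.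
rewrite big1 ?add0r => [|f _]; last by rewrite Qlast ?out_last.
rewrite (eq_bigr (fun a : darc m => \sum_(b in tau :\ e) Qb a b)); last first.
  by move=> a _; rewrite sum_insert_last !Qlast ?in_last ?out_last ?orbT ?add0r.
rewrite [in RHS](big_setD1 e) //=.
rewrite [X in _ = _ + X - _](eq_bigr (fun a =>
  Qb e a + \sum_(b in tau :\ e) Qb a b)); last first.
  by move=> a _; rewrite (big_setD1 e) //= /Qb /delete_last Qsym.
rewrite big_split /= (big_setD1 e (F := Qb e)) //= Qbee.
ring.
Qed.

Lemma linearizable_insert (R : realType) m (Q : arc_matrix R m.+1)
    (C : 'M[R]_m.+1) :
    (2 <= m)%N -> quadratic_reduced_form Q ->
  is_linearization Q C <->
  forall (tau : {set darc m}) (e : darc m), is_tour tau -> e \in tau ->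
    quad_cost (delete_last Q) tau
      - 2 * lin_cost (row_matrix (delete_last Q) e) tau
    = lin_cost C (insert_last tau e).
Proof.
move=> hm hQ; split=> [hC tau e htau he|hC sigma].
  rewrite -hC; last exact: is_tour_insert_last.
  by rewrite quad_cost_insert_last.
move=> /(is_tour_insert_lastP hm) [tau [e [htau he ->]]].
by rewrite quad_cost_insert_last // hC.
Qed.

Lemma sum_lin_cost_row_matrix (R : realType) k (Q : arc_matrix R k)
    (tau : {set darc k}) :
  (forall e, Q e e = 0) ->
  \sum_(e in tau) lin_cost (row_matrix Q e) tau = quad_cost Q tau.
Proof. by move=> hQ; apply: eq_bigr => e _; apply: lin_cost_row_matrix. Qed.

Theorem theorem6 (R : realType) (n : nat) (hn : (4 <= n)%N)
    (Q : arc_matrix R n) (hQ : quadratic_reduced_form Q) :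
  linearizable Q <->
  exists F : 'M[R]_n.-1,
    (forall (tau : {set darc n.-1}) (e f : darc n.-1),
        is_tour tau -> e \in tau -> f \in tau ->
        lin_cost (row_matrix (delete_last Q) e) tau
          - lin_cost (row_matrix (delete_last Q) f) tau
        = 1 / 2 * (F (arc_tail e) (arc_head e) - F (arc_tail f) (arc_head f)))
    /\ is_linearization (delete_last Q)
         (((n%:R - 2) / (n%:R - 3)) *: F).
Proof.
case: n hn Q hQ => [//|m] hm Q hQ.
have hm2 : (2 <= m)%N := ltnW hm.
have Qbdiag (e : darc m) : delete_last Q e e = 0 by case: hQ => _ + _; apply.
(* With [M] = n - 1, the length of the shorter tours, the factor (n - 2) / (n - 3) becomes (M - 1) /
   (M - 2). *)
have m_ge3 : (3 : R) <= m%:R by rewrite Num.Theory.ler_nat.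
rewrite -(natr1 m) /=; set M : R := m%:R in m_ge3 *.
have hM0 : M != 0 by lra.
have hM1 : M - 1 != 0 by lra.
have hM2 : M - 2 != 0 by lra.
have -> : (M + 1 - 2) / (M + 1 - 3) = (M - 1) / (M - 2).
  by congr (_ / _); ring.
have sumc (tau : {set darc m}) (c : R) : is_tour tau ->
    \sum_(e in tau) c = M * c.
  by move=> ht; rewrite sumr_const card_tour // mulr_natl.
split=> [[C /(linearizable_insert _ hm2 hQ) hC]|[F [hF1 hF2]]].
- pose w : 'I_m -> 'I_m.+1 := @widen_vertex m.+1.
  pose B : 'M[R]_m := \matrix_(i, j) C (w i) (w j).
  pose S := \sum_i C (w i) ord_max + \sum_i C ord_max (w i).
  pose G i j : R := B i j - C (w i) ord_max - C ord_max (w j).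
  have hG tau e : is_tour tau -> e \in tau ->
      quad_cost (delete_last Q) tau
        - 2 * lin_cost (row_matrix (delete_last Q) e) tau
      = lin_cost B tau - G (arc_tail e) (arc_head e).
    move=> ht he; rewrite hC // (@lin_cost_insert_last _ _ _ B) //.
    by move=> i j; rewrite mxE.
  have sumG (tau : {set darc m}) : is_tour tau ->
      \sum_(e in tau) G (arc_tail e) (arc_head e) = lin_cost B tau - S.
    move=> ht; rewrite !sumrB (sum_tour_tail (fun i => C (w i) ord_max)) //.
    by rewrite (sum_tour_head (fun i => C ord_max (w i))) // /S opprD addrA.
  (* A constant shift cancels in (1). Writing q for the quadratic cost and b for B(tau), summing
     [hG] over the tour gives (M - 2) q = (M - 1) b + S. A shift c has to satisfy (M - 1) (b - S + M
     c) = (M - 1) b + S, hence c = S / (M - 1). *)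
  exists (\matrix_(i, j) (G i j + S / (M - 1))); split=> [tau e f ht he hf|tau ht].
    by have := hG tau e ht he; have := hG tau f ht hf; rewrite !mxE; lra.
  have : \sum_(e in tau) (quad_cost (delete_last Q) tau
        - 2 * lin_cost (row_matrix (delete_last Q) e) tau)
      = \sum_(e in tau) (lin_cost B tau - G (arc_tail e) (arc_head e)).
    by apply: eq_bigr => e he; apply: hG.
  rewrite [LHS]sumrB [RHS]sumrB !sumc // -mulr_sumr sum_lin_cost_row_matrix //.
  rewrite sumG //.
  rewrite [lin_cost (_ *: _) _](_ : _ =
    (M - 1) / (M - 2) * (lin_cost B tau - S + M * (S / (M - 1)))); last first.
    rewrite -sumG // -(sumc tau) // -big_split mulr_sumr.
    by apply: eq_bigr => e _; rewrite !mxE.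
  set q := quad_cost _ _; set b := lin_cost B _ => h.
  apply: (mulfI hM2); rewrite [LHS](_ : _ = M * q - 2 * q); last by ring.
  by rewrite h; field; rewrite hM1.
(* [unlift ord_max] is [None] exactly at the last vertex, so this extends [F] by a zero row and
   column. *)
exists (\matrix_(i, j)
  if unlift ord_max i is Some i' then
    if unlift ord_max j is Some j' then F i' j' else 0
  else 0).
apply/(linearizable_insert _ hm2 hQ) => tau e ht he.
have unliftw (i : 'I_m) : unlift ord_max (@widen_vertex m.+1 i) = Some i.
  rewrite (_ : @widen_vertex m.+1 i = lift ord_max i) ?liftK //.
  by apply: val_inj; rewrite /= /bump leqNgt ltn_ord.
rewrite (@lin_cost_insert_last _ _ _ F) //; last first.
  by move=> i j; rewrite mxE !unliftw.
rewrite !mxE !unlift_none unliftw !subr0.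
(* Summing (1) over the second arc with [e] fixed expresses M Z^e(tau) through the quadratic cost,
   F_e and F(tau); (2) then eliminates the quadratic cost. *)
have : \sum_(f in tau) (lin_cost (row_matrix (delete_last Q) e) tau
          - lin_cost (row_matrix (delete_last Q) f) tau)
   = \sum_(f in tau) (1 / 2 * (F (arc_tail e) (arc_head e)
          - F (arc_tail f) (arc_head f))).
  by apply: eq_bigr => f hf; apply: hF1.
rewrite -mulr_sumr !sumrB !sumc // sum_lin_cost_row_matrix //.
rewrite -/(lin_cost F tau).
have -> : quad_cost (delete_last Q) tau = (M - 1) / (M - 2) * lin_cost F tau.
  rewrite hF2 // /lin_cost mulr_sumr.
  by apply: eq_bigr => a _; rewrite mxE.
set z := lin_cost (row_matrix _ _) _; set f := lin_cost F _; set g := F _ _ => h.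
apply: (mulfI hM0).
(* The goal, multiplied by [M], is regrouped so that the left side of [h] appears. *)
have -> : M * ((M - 1) / (M - 2) * f - 2 * z)
  = M * ((M - 1) / (M - 2) * f) - 2 * (M * z - (M - 1) / (M - 2) * f)
      - 2 * ((M - 1) / (M - 2) * f) by ring.
by rewrite h; field.
Qed.
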